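(* Let $q$ be a prime power, and let $$f(T)=\det\begin{pmatrix} 1 & T^2 & (T^2)^2 & (T^3)^2 & (T^4)^2 & (T^5)^2\\ 1 & T^{2q} & (T^2)^{2q} & (T^3)^{2q} & (T^4)^{2q} & (T^5)^{2q}\\ 1 & T^{2q^2} & (T^2)^{2q^2} & (T^3)^{2q^2} & (T^4)^{2q^2} & (T^5)^{2q^2}\\ 1 & T^{q+1} & (T^2)^{q+1} & (T^3)^{q+1} & (T^4)^{q+1} & (T^5)^{q+1}\\ 1 & T^{q^2+q} & (T^2)^{q^2+q} & (T^3)^{q^2+q} & (T^4)^{q^2+q} & (T^5)^{q^2+q}\\ 1 & T^{q^2+1} & (T^2)^{q^2+1} & (T^3)^{q^2+1} & (T^4)^{q^2+1} & (T^5)^{q^2+1} \end{pmatrix}\in\mathbb{F}_q[T].$$ If $\xi\in\mathbb{F}_{q^3}$ is not a root of $f(T)$, then $$\{\xi^i\operatorname{Tr}_{q^3/q}(\xi^ix): i\in\{0,\ldots,5\}\}$$ is a symmetric tensor decomposition of $M_{q^3}$, that is, its $\mathbb{F}_q$-span contains $\langle x\rangle_{\mathbb{F}_{q^3}}$. This decomposition is optimal for $q\in\{2,3\}$, that is, $\mu_q^{\mathrm{sym}}(3)=6$ for $q\in\{2,3\}$.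
   Context: For a positive integer $m$, the symmetric tensor rank $\mu_q^{\mathrm{sym}}(m)$ of the multiplication map $M_{q^m}:\mathbb{F}_{q^m}\times\mathbb{F}_{q^m}\to\mathbb{F}_{q^m}$, $(\alpha,\beta)\mapsto\alpha\beta$, is the smallest integer $R$ for which there exist $\mathbb{F}_q$-linear forms $\phi_1,\ldots,\phi_R:\mathbb{F}_{q^m}\to\mathbb{F}_q$ and elements $w_1,\ldots,w_R\in\mathbb{F}_{q^m}$ with $\alpha\beta=\sum_{i=1}^R\phi_i(\alpha)\phi_i(\beta)w_i$ for all $\alpha,\beta\in\mathbb{F}_{q^m}$. $\operatorname{Tr}_{q^m/q}(x)=\sum_{j=0}^{m-1}x^{q^j}$ is the field trace. Linearized polynomials $\sum_{i=0}^{m-1}a_ix^{q^i}$ with $a_i\in\mathbb{F}_{q^m}$ (taken modulo $x^{q^m}-x$) are identified with $\mathbb{F}_q$-linear maps on $\mathbb{F}_{q^m}$, and $\langle x\rangle_{\mathbb{F}_{q^m}}=\{ax:a\in\mathbb{F}_{q^m}\}$. A symmetric tensor decomposition of length $R$ is optimal if $R=\mu_q^{\mathrm{sym}}(m)$. *)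

(* Defs.v *)
From HB Require Import structures.
From mathcomp Require Import all_boot all_order all_algebra all_field.

Set Implicit Arguments.
Unset Strict Implicit.
Unset Printing Implicit Defensive.

Import GRing.Theory.
Local Open Scope ring_scope.

(* F plays the role of the field with q = #|F| elements, and an extension L of
   dimension m over F that of the field with q ^ m elements. *)

Section TensorDecomposition.

Variables (F : finFieldType) (L : fieldExtType F).

Definition sym_tensor_decomposition (R : nat)
    (phi : 'I_R -> 'Hom(L, F^o)) (w : 'I_R -> L) : Prop :=
  forall a b : L, a * b = \sum_(i < R) (phi i a * phi i b) *: w i.

Definition has_sym_tensor_decomposition (R : nat) : Prop :=
  exists (phi : 'I_R -> 'Hom(L, F^o)) (w : 'I_R -> L),
    sym_tensor_decomposition phi w.

(* mu_q^sym(m) = R *)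
Definition is_sym_tensor_rank (R : nat) : Prop :=
  has_sym_tensor_decomposition R /\
  (forall R' : nat, has_sym_tensor_decomposition R' -> (R <= R')%N).

(* The trace, as a map from L to itself: its values lie in the copy 1%VS of F
   inside L. *)
Definition field_trace (x : L) : L :=
  \sum_(j < \dim {:L}) x ^+ (#|F| ^ j).

Definition trace_tensor (b : L) : 'End(L) :=
  linfun (fun x : L => b * field_trace (b * x)).

Lemma field_trace_is_linear : linear field_trace.
Proof.
move=> k x y; rewrite /field_trace scaler_sumr -big_split /=.
apply: eq_bigr => j _; have [p p_pr pcharF] := finPcharP F.
have pcharL : p \in [pchar L] by rewrite pchar_lalg.
have qj_pnat : [pchar L].-nat (#|F| ^ j)%N.
  rewrite (eq_pnat _ (pcharf_eq pcharL)) pnatX.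
  by rewrite (card_pprimeChar pcharF) pnatX pnat_id.
rewrite exprDn_pchar // exprZn; congr (_ *: _ + _).
by elim: {qj_pnat} (j : nat) => [|i IHi]; rewrite ?expr1 // expnSr exprM IHi expf_card.
Qed.

(* linfun is meaningful only on linear functions; this checks that it is in
   trace_tensor. *)
Lemma trace_tensorE (b x : L) : trace_tensor b x = b * field_trace (b * x).
Proof.
pose f x := b * field_trace (b * x).
have f_lin : linear f.
  by move=> k y z; rewrite /f mulrDr -scalerAr field_trace_is_linear mulrDr scalerAr.
pose fM := GRing.isLinear.Build F L L _ f f_lin.
pose fL : {linear L -> L} := HB.pack f fM.
exact: (lfunE fL).
Qed.

Definition power_trace_tensors (xi : L) : seq 'End(L) :=
  [seq trace_tensor (xi ^+ i) | i <- iota 0 6].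

End TensorDecomposition.

Definition row_exponents (q : nat) : seq nat :=
  [:: 2; 2 * q; 2 * q ^ 2; q + 1; q ^ 2 + q; q ^ 2 + 1]%N.

Definition det_poly (F : finFieldType) : {poly F} :=
  \det (\matrix_(k < 6, i < 6) ('X^i) ^+ nth 0%N (row_exponents #|F|) k).

(* Main.v *)
From HB Require Import structures.
Require Import Defs.
From mathcomp Require Import all_boot all_order all_algebra all_field.
From mathcomp Require Import ring.

Set Implicit Arguments.
Unset Strict Implicit.
Unset Printing Implicit Defensive.

Import GRing.Theory.
Local Open Scope ring_scope.

(** Write [b_i = xi ^+ i].  Expanding [Tr (b_i x) * Tr (b_i y)] for a cubic
    extension gives nine monomials [x ^+ (q ^ j) * y ^+ (q ^ k)], and the
    coefficient of each is [b_i ^+ (q ^ j + q ^ k)], one of the six entries of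
    column [i] of the matrix that defines [f].  Hence
    [x * y = \sum_i (Tr (b_i x) * Tr (b_i y)) *: w_i] holds as soon as the
    vector [w] solves the linear system with that matrix and right-hand side
    [(1, 0, 0, 0, 0, 0)], and [f(xi) != 0] makes it solvable
    ([quad_mx_decomposition]).

    The statement about endomorphisms is the dual one.  Multiplying the
    decomposition by [a] and taking traces gives
    [Tr (y * a x) = Tr (y * \sum_i Tr (a w_i) *: (b_i * Tr (b_i x)))] for all
    [y], and the trace form is nondegenerate ([amull_trace_tensors]).

    For optimality, the forms of a decomposition of length [R] embed [L] as a
    code of length [R] over [F] in which every nonzero word has weight at least
    [3], because [a * L] is all of [L] ([decomposition_support]).  With
    [R = 5] any three forms vanish together only at [0]: they are five points in
    general position in a projective plane, a frame together with one more
    point.  The coordinates of the last point in that frame are three distinct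
    nonzero scalars, so [q >= 4] ([no_decomposition5]).  Six forms always
    suffice, by polarization of the products of coordinates
    ([has_decomposition6]).  The six tensors of the statement are distinct
    because equal tensors would give equal columns of the matrix
    ([trace_tensor_inj]), so that their number really is the rank. *)

(** * Traces and linearized polynomials *)

Section Trace.
Variables (F : finFieldType) (L : fieldExtType F).
Local Notation q := #|F|.

HB.instance Definition _ :=
  GRing.isLinear.Build F L L _ (@field_trace F L) (@field_trace_is_linear F L).

Lemma exprD_card (x y : L) : (x + y) ^+ q = x ^+ q + y ^+ q.
Proof.
have [p p_pr pcharF] := finPcharP F.
have pcharL : p \in [pchar L] by rewrite pchar_lalg.
apply: exprDn_pchar; rewrite (eq_pnat _ (pcharf_eq pcharL)).
by rewrite (card_pprimeChar pcharF) pnatX pnat_id.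
Qed.

Lemma expr_sum_card I (r : seq I) (P : pred I) (E : I -> L) :
  (\sum_(i <- r | P i) E i) ^+ q = \sum_(i <- r | P i) E i ^+ q.
Proof.
apply: (big_morph (fun x : L => x ^+ q) exprD_card).
by rewrite expr0n (gtn_eqF (ltnW (finNzRing_gt1 F))).
Qed.

Lemma card_finvect : #|finvect_type L| = (q ^ \dim {:L})%N.
Proof.
rewrite -(card_vspacef (Vector.class (finvect_type L : vectType F))).
by rewrite card_vspace.
Qed.

Lemma expr_card_ext (x : L) : x ^+ (q ^ \dim {:L}) = x.
Proof. by rewrite -card_finvect -[RHS](@expf_card (finvect_type L)). Qed.

(** Such a polynomial has degree at most [q ^ (m - 1)], too small for the
    [q ^ m] elements of [L] all to be roots. *)
Lemma linearized_coef_eq0 (c : 'I_(\dim {:L}) -> L) :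
  (forall x : L, \sum_j c j * x ^+ (q ^ j) = 0) -> forall j, c j = 0.
Proof.
move=> c0 j; pose P := \sum_i c i *: 'X^(q ^ i) : {poly L}.
have q_gt1 : (1 < q)%N := finNzRing_gt1 F.
suff P0 : P = 0.
  rewrite -[RHS](coef0 _ (q ^ j)) -P0 coef_sum (bigD1 j) //= big1 => [|i ne_ij].
    by rewrite coefZ coefXn eqxx mulr1 addr0.
  by rewrite coefZ coefXn eqn_exp2l // eq_sym (inj_eq val_inj) (negPf ne_ij)
       mulr0.
apply/eqP/negPn/negP => P_neq0.
have P_root : all (root P) (enum (finvect_type L) : seq L).
  apply/allP=> x _; apply/rootP; rewrite horner_sum -[RHS](c0 x).
  by apply: eq_bigr => i _; rewrite hornerZ hornerXn.
have : (size (enum (finvect_type L)) < size P)%N.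
  exact: max_poly_roots P_neq0 P_root (enum_uniq _).
rewrite -cardE card_finvect ltnNge => /negP[].
apply: leq_trans (size_sum _ _ _) _; apply/bigmax_leqP => i _.
by apply: leq_trans (size_scale_leq _ _) _; rewrite size_polyXn ltn_exp2l.
Qed.

(** The [q] elements of [F] exhaust the roots of ['X^q - 'X] in [L]. *)
Lemma expf_card_eq_in1v (x : L) : x ^+ q = x -> x \in 1%VS.
Proof.
move=> xq; have /(congr1 (map_poly (in_alg L))) := finField_genPoly F.
move=> /(congr1 (horner^~ x)).
rewrite rmorphB rmorph_prod /= map_polyX map_polyXn !hornerE xq subrr.
rewrite horner_prod => /esym/eqP/prodf_eq0[a _].
rewrite rmorphB /= map_polyX map_polyC !hornerE subr_eq0 => /eqP->.
exact: rpredZ (mem1v _).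
Qed.

(** Raising to the power [q] permutes the conjugates of [x] cyclically. *)
Lemma field_trace_in1v (x : L) : field_trace x \in 1%VS.
Proof.
apply: expf_card_eq_in1v; rewrite /field_trace expr_sum_card.
under eq_bigr do rewrite -exprM -expnSr.
have := expr_card_ext x; case: (\dim _) => [_|m xm]; first by rewrite !big_ord0.
by rewrite big_ord_recr big_ord_recl /= xm expn0 expr1 addrC.
Qed.

(** The values of the trace lie on the line spanned by [1], so their coordinate
    with respect to [1] loses nothing. *)
Definition trace_scalar (b x : L) : F :=
  coord [tuple (1 : L)] ord0 (field_trace (b * x)).

Lemma trace_scalarE (b x : L) : (trace_scalar b x)%:A = field_trace (b * x).
Proof.
have /coord_span : field_trace (b * x) \in <<[tuple (1%R : L)]>>%VS.
  by rewrite span_seq1 field_trace_in1v.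
by rewrite big_ord1.
Qed.

(** Scalar forms take values in the ring [F], elements of ['Hom(L, F^o)] in the
    module [F^o]; this passes from the first to the second. *)
Lemma linfun_scalarE (f : {scalar L}) (x : L) :
  linfun (f : L -> F^o) x = f x.
Proof.
have f_lin : linear (f : L -> F^o) by move=> k y z; rewrite linearP.
pose fL : {linear L -> F^o} := HB.pack (f : L -> F^o)
  (GRing.isLinear.Build F L F^o _ _ f_lin).
exact: (lfunE fL x).
Qed.

Definition trace_form (b : L) : 'Hom(L, F^o) :=
  linfun (trace_scalar b : L -> F^o).

Lemma trace_scalar_is_scalar (b : L) : scalar (trace_scalar b).
Proof.
move=> k y z; rewrite /trace_scalar mulrDr -scalerAr field_trace_is_linear.
by rewrite linearP.
Qed.

HB.instance Definition _ (b : L) :=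
  GRing.isLinear.Build F L F _ (trace_scalar b) (trace_scalar_is_scalar b).

Lemma trace_formE (b x : L) : trace_form b x = trace_scalar b x.
Proof. exact: linfun_scalarE. Qed.

Lemma field_trace_nondegenerate (z : L) :
  (forall y, field_trace (y * z) = 0) -> z = 0.
Proof.
move=> z0; have := @linearized_coef_eq0 (fun j => z ^+ (q ^ j)) _.
move=> /(_ _ (Ordinal (adim_gt0 {:L}))) /=; rewrite expn0 expr1; apply=> x.
by rewrite -[RHS](z0 x); apply: eq_bigr => j _; rewrite exprMn mulrC.
Qed.

(** After multiplication by [y] and application of the trace, both sides become
    [\sum_i Tr (a w_i) * Tr (b_i x) * Tr (b_i y)]: the left one by decomposing
    [x * y], the right one by linearity. *)
Lemma amull_trace_tensors n (b w : 'I_n -> L) :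
  (forall x y, x * y
     = \sum_i (trace_scalar (b i) x * trace_scalar (b i) y) *: w i) ->
  forall a, amull a = \sum_i trace_scalar a (w i) *: trace_tensor (b i).
Proof.
move=> dec a; apply/lfunP => x; rewrite lfunE /= sum_lfunE.
apply/eqP; rewrite -subr_eq0; apply/eqP.
apply: field_trace_nondegenerate => y.
have -> : y * (a * x - \sum_i (trace_scalar a (w i) *: trace_tensor (b i)) x)
   = \sum_i (a * ((trace_scalar (b i) x * trace_scalar (b i) y) *: w i)
             - trace_scalar a (w i) *: (trace_scalar (b i) x *: (b i * y))).
  rewrite sumrB -mulr_sumr -dec mulrBr mulrCA [y * x]mulrC.
  congr (_ - _); rewrite mulr_sumr; apply: eq_bigr => i _.
  rewrite scale_lfunE trace_tensorE -trace_scalarE -scalerAr mulrCA.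
  by rewrite -!scalerAr mulr1.
rewrite raddf_sum big1 // => i _.
rewrite raddfB /= -scalerAr !linearZ /= -!trace_scalarE !scalerA.
rewrite scalerN scalerA -scalerBl (_ : _ - _ = 0) ?scale0r //; ring.
Qed.
End Trace.

(** * Tensors of a cubic extension *)

Section Cubic.
Variables (F : finFieldType) (L : fieldExtType F).
Hypothesis dimL : \dim {:L} = 3%N.
Local Notation q := #|F|.

(** Column [i] holds, up to the symmetry between [x] and [y], the coefficients
    of the monomials [x ^+ (q ^ j) * y ^+ (q ^ k)] in [Tr (b_i x) * Tr (b_i y)]. *)
Definition quad_mx (b : 'I_6 -> L) : 'M[L]_6 :=
  \matrix_(k, i) b i ^+ nth 0%N (row_exponents q) k.

Lemma field_trace_cubic (x : L) :
  field_trace x = x + x ^+ q + x ^+ (q ^ 2).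
Proof.
by rewrite /field_trace dimL !big_ord_recr big_ord0 /= add0r expn0 expn1 expr1.
Qed.

Lemma quad_mx_decomposition (b : 'I_6 -> L) : \det (quad_mx b) != 0 ->
  exists w : 'I_6 -> L, forall x y : L, x * y
    = \sum_i (trace_scalar (b i) x * trace_scalar (b i) y) *: w i.
Proof.
rewrite -unitfE => detM; pose M := quad_mx b; pose w i := invmx M i ord0.
have Mw k : \sum_i M k i * w i = (k == ord0)%:R.
  by have /matrixP/(_ k ord0) := @mulmxV _ _ M detM; rewrite !mxE.
exists w => x y.
(* [c] lists the symmetrized monomials in the order of [row_exponents]. *)
pose c := [:: x * y; x ^+ q * y ^+ q; x ^+ (q ^ 2) * y ^+ (q ^ 2);
  x * y ^+ q + x ^+ q * y;
  x ^+ q * y ^+ (q ^ 2) + x ^+ (q ^ 2) * y ^+ q;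
  x * y ^+ (q ^ 2) + x ^+ (q ^ 2) * y].
transitivity (\sum_k \sum_i M k i * w i * c`_k).
  under eq_bigr do rewrite -mulr_suml Mw.
  by rewrite big_ord_recl big1 ?mul1r ?addr0 // => k _; rewrite mul0r.
rewrite exchange_big; apply: eq_bigr => i _ /=.
rewrite -scalerA -[RHS]mulr_algl -[_ *: w i]mulr_algl.
rewrite !trace_scalarE !field_trace_cubic !exprMn.
rewrite !big_ord_recl big_ord0 !mxE /=.
move: #|F| (#|F| ^ 2)%N => s t.
rewrite !(mulnC 2%N) !exprM !exprD !expr1.
ring.
Qed.

(** As linearized polynomials the two tensors have coefficients
    [b ^+ (q ^ j + 1)] and [c ^+ (q ^ j + 1)]; the remaining exponents are
    multiples of these by powers of [q]. *)
Lemma trace_tensor_eq_pow (b c : L) : trace_tensor b = trace_tensor c ->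
  forall k : 'I_6, b ^+ nth 0%N (row_exponents q) k
                   = c ^+ nth 0%N (row_exponents q) k.
Proof.
move=> eq_bc.
pose d (j : 'I_(\dim {:L})) := b ^+ (q ^ j + 1) - c ^+ (q ^ j + 1).
have d0 : forall j, d j = 0.
  apply: linearized_coef_eq0 => x.
  have /eqP := congr1 (fun f : 'End(L) => f x) eq_bc.
  rewrite !trace_tensorE -subr_eq0 /field_trace !mulr_sumr -sumrB => /eqP bc0.
  rewrite -[RHS]bc0; apply: eq_bigr => j _.
  by rewrite /d !exprMn !exprD !expr1; ring.
have bcE j : (j < 3)%N -> b ^+ (q ^ j + 1) = c ^+ (q ^ j + 1).
  rewrite -{1}dimL => lt_j; apply/eqP; rewrite -subr_eq0; apply/eqP.
  exact: (d0 (Ordinal lt_j)).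
have e2 : b ^+ 2 = c ^+ 2 := bcE 0%N isT.
have eq1 : b ^+ (q + 1) = c ^+ (q + 1) by have := bcE 1%N isT; rewrite expn1.
have pw e e' : (e' = e * q)%N -> b ^+ e = c ^+ e -> b ^+ e' = c ^+ e'.
  by move=> -> bce; rewrite !exprM bce.
case=> [[|[|[|[|[|[|k]]]]]] ltk] //=; last exact: (bcE 2%N isT).
- exact: pw e2.
- by apply: (@pw (2 * q)%N); [rewrite -mulnA mulnn | apply: pw e2].
- by apply: pw eq1; rewrite mulnDl mul1n mulnn.
Qed.

Lemma trace_tensor_inj (b : 'I_6 -> L) : \det (quad_mx b) != 0 ->
  injective (fun i => trace_tensor (b i)).
Proof.
move=> detM i j /trace_tensor_eq_pow eq_ij; apply/eqP.
apply: contraR detM => ne_ij; rewrite -det_tr.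
by apply/eqP/(determinant_alternate ne_ij) => k; rewrite !mxE eq_ij.
Qed.

Lemma det_quad_mx_pow (xi : L) :
  \det (quad_mx (fun i => xi ^+ i)) = (map_poly (in_alg L) (det_poly F)).[xi].
Proof.
rewrite -horner_evalE /det_poly -!det_map_mx; congr (\det _).
by apply/matrixP => k i; rewrite !mxE /= !rmorphXn /= map_polyX
   horner_evalE hornerX.
Qed.

End Cubic.

(** * Rank six over fields with at most three elements *)

Section Rank.
Variables (F : finFieldType) (L : fieldExtType F).
Local Notation q := #|F|.

(** Every [c] equals [a * (a^-1 * c)], hence lies in the span of the [w i] for
    which [phi i a] does not vanish. *)
Lemma decomposition_support R (phi : 'I_R -> 'Hom(L, F^o)) (w : 'I_R -> L) :
  sym_tensor_decomposition phi w ->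
  forall a : L, a != 0 -> (\dim {:L} <= #|[set i | phi i a != 0%R]|)%N.
Proof.
move=> dec a a_neq0; set S := [set i | _].
apply: leq_trans (_ : \dim <<[seq w i | i <- enum S]>> <= _)%N; last first.
  by apply: leq_trans (dim_span _) _; rewrite size_map -cardE.
apply/dimvS/subvP => c _; rewrite -[c](mulVKf a_neq0) dec.
apply: memv_suml => i _; have [->|nz] := eqVneq (phi i a) 0.
  by rewrite mul0r scale0r mem0v.
by apply/rpredZ/memv_span/map_f; rewrite mem_enum inE.
Qed.

Lemma has_decompositionS R :
  has_sym_tensor_decomposition L R -> has_sym_tensor_decomposition L R.+1.
Proof.
case=> phi [w dec].
exists (fun i => if unlift ord0 i is Some j then phi j else 0).
exists (fun i => if unlift ord0 i is Some j then w j else 0) => a b.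
rewrite big_ord_recl unlift_none scaler0 add0r dec.
by apply: eq_bigr => i _; rewrite liftK.
Qed.

Lemma has_decomposition_leq R R' : (R <= R')%N ->
  has_sym_tensor_decomposition L R -> has_sym_tensor_decomposition L R'.
Proof.
by move=> /subnK <-; elim: (R' - R)%N => // n IHn /IHn;
  apply: has_decompositionS.
Qed.

Lemma common_zero (f g : 'Hom(L, F^o)) : (2 < \dim {:L})%N ->
  exists a : L, [/\ a != 0, f a = 0 & g a = 0].
Proof.
have dim_ker (U : {vspace L}) (h : 'Hom(L, F^o)) :
  (\dim U <= (\dim (U :&: lker h)).+1)%N.
  rewrite -(limg_ker_dim h U) -addn1 leq_add2l.
  by apply: leq_trans (dimvS (subvf _)) _; rewrite dimvf.
move=> dimL; pose V := (lker f :&: lker g)%VS.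
have V_neq0 : V != 0%VS.
  have := leq_trans dimL (dim_ker fullv f); rewrite capfv ltnS => dim_f.
  by have := leq_trans dim_f (dim_ker (lker f) g); rewrite ltnS lt0n dimv_eq0.
exists (vpick V); have := memv_pick V.
by rewrite memv_cap !memv_ker vpick0 => /andP[/eqP fa /eqP ga].
Qed.

(** A nonzero vector is killed by at most two of the five forms.  Let [a0], [a1]
    and [a2] be the basis dual, up to scaling, to the forms [0], [1] and [2].
    If the quotient of forms [3] and [4] took the same value at two of these
    vectors, a combination of both would be killed by forms [3], [4] and one of
    the first three.  So the three quotients are distinct and nonzero. *)
Lemma no_decomposition5 : \dim {:L} = 3%N -> (q <= 3)%N ->
  ~ has_sym_tensor_decomposition L 5.
Proof.
move=> dimL q_le3 [phi [w dec]].
have three_zeros a i j k : uniq [:: i; j; k] ->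
  phi i a = 0 -> phi j a = 0 -> phi k a = 0 -> a = 0.
  move=> u_ijk ai aj ak; apply/eqP; apply/negPn/negP => a_neq0.
  have := decomposition_support dec a_neq0; rewrite dimL leqNgt => /negP[].
  have := cardsC [set i | phi i a != 0]; rewrite card_ord.
  suff : (3 <= #|~: [set i | phi i a != 0%R]|)%N.
    by move=> c3 c5; rewrite -(ltn_add2r 3) ltnS -[leqRHS]c5 leq_add2l.
  rewrite -[leqLHS]/(size [:: i; j; k]) -(card_uniqP u_ijk).
  apply/subset_leq_card.
  by apply/subsetP => l; rewrite !inE negbK => /or3P[] /eqP ->; apply/eqP.
have nonzero a i j k : uniq [:: i; j; k] ->
    a != 0 -> phi i a = 0 -> phi j a = 0 -> (phi k a : F) != 0.
  move=> u_ijk a_neq0 ai aj; apply: contra a_neq0 => /eqP ak.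
  exact/eqP/(three_zeros a i j k).
pose o k (k5 : (k < 5)%N) : 'I_5 := Ordinal k5.
pose o0 := o 0%N isT; pose o1 := o 1%N isT; pose o2 := o 2%N isT.
pose o3 := o 3%N isT; pose o4 := o 4%N isT.
pose r a : F := (phi o3 a : F) / (phi o4 a : F).
have r_neq i j k a b : uniq [:: i; j; k; o3; o4] -> a != 0 -> b != 0 ->
    phi j a = 0 -> phi k a = 0 -> phi i b = 0 -> phi k b = 0 -> r a != r b.
  rewrite /= !inE !negb_or -!andbA.
  case/and5P=> ij ik i3 i4 /and5P[jk j3 j4 k3 /andP[k4 _]] a0 b0 aj ak bi bk.
  have ai : (phi i a : F) != 0.
    by apply: (nonzero a j k) => //=;
      rewrite !inE negb_or jk ![_ == i]eq_sym ij ik.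
  have a4 : (phi o4 a : F) != 0.
    by apply: (nonzero a j k) => //=; rewrite !inE negb_or jk j4 k4.
  have b4 : (phi o4 b : F) != 0.
    by apply: (nonzero b i k) => //=; rewrite !inE negb_or ik i4 k4.
  apply/eqP => /eqP; rewrite /r eqr_div // => /eqP eq_r.
  (* This combination is killed by form [4] by construction, by form [3] because
     the quotients agree, and by form [k]; but not by form [i]. *)
  pose c := (phi o4 b : F) *: a - (phi o4 a : F) *: b.
  have phiE l : phi l c = (phi o4 b : F) * phi l a - (phi o4 a : F) * phi l b.
    by rewrite linearB !linearZ.
  have c0 : c = 0.
    apply: (three_zeros c k o3 o4).
    - by rewrite /= !inE negb_or k3 k4.
    - by rewrite phiE ak bk !mulr0 subrr.
    - by rewrite phiE mulrC eq_r mulrC subrr.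
    - by rewrite phiE mulrC subrr.
  have := phiE i; rewrite c0 linear0 bi mulr0 subr0 => /esym/eqP.
  by rewrite mulf_eq0 (negPf b4) (negPf ai).
have dim2 : (2 < \dim {:L})%N by rewrite dimL.
have [a0 [nz0 a01 a02]] := common_zero (phi o1) (phi o2) dim2.
have [a1 [nz1 a10 a12]] := common_zero (phi o0) (phi o2) dim2.
have [a2 [nz2 a20 a21]] := common_zero (phi o0) (phi o1) dim2.
have r_neq0 i j a : uniq [:: i; j; o3] -> uniq [:: i; j; o4] -> a != 0 ->
    phi i a = 0 -> phi j a = 0 -> 0 != r a.
  move=> u3 u4 a_nz ai aj; rewrite eq_sym mulf_neq0 ?invr_eq0 //.
    exact: (nonzero a i j).
  exact: (nonzero a i j).
have : uniq [:: 0; r a0; r a1; r a2].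
  rewrite /= !inE !negb_or (r_neq0 o1 o2 a0) // (r_neq0 o0 o2 a1) //.
  rewrite (r_neq0 o0 o1 a2) // (r_neq o0 o1 o2 a0 a1) //.
  by rewrite (r_neq o0 o2 o1 a0 a2) // (r_neq o1 o2 o0 a1 a2).
move=> /card_uniqP; have := max_card (mem [:: 0; r a0; r a1; r a2]).
by move=> + u; rewrite u /= leqNgt ltnS q_le3.
Qed.

(** With coordinates [x_i] and [y_i], the products [x_i * y_i] already have the
    required form, and for the mixed terms
    [x_i y_j + x_j y_i = (x_i + x_j) (y_i + y_j) - x_i y_i - x_j y_j]. *)
Lemma has_decomposition6 : \dim {:L} = 3%N -> has_sym_tensor_decomposition L 6.
Proof.
move=> dimL.
have [e e_basis] : exists e : 3.-tuple L, basis_of {:L} e.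
  by rewrite -dimL; exists (vbasis {:L}); apply: vbasisP.
pose X i : 'Hom(L, F^o) := linfun (coord e i : L -> F^o).
pose i0 : 'I_3 := @Ordinal 3 0 isT; pose i1 : 'I_3 := @Ordinal 3 1 isT.
pose i2 : 'I_3 := @Ordinal 3 2 isT.
pose phi := [:: X i0; X i1; X i2; X i0 + X i1; X i0 + X i2; X i1 + X i2].
pose w := [:: e`_0 * (e`_0 - e`_1 - e`_2); e`_1 * (e`_1 - e`_0 - e`_2);
  e`_2 * (e`_2 - e`_0 - e`_1); e`_0 * e`_1; e`_0 * e`_2; e`_1 * e`_2].
exists (fun i => phi`_i), (fun i => w`_i) => a b.
have coordE c : c = (X i0 c : F)%:A * e`_0 + (X i1 c : F)%:A * e`_1
                    + (X i2 c : F)%:A * e`_2.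
  rewrite {1}(coord_basis e_basis (memvf c)) !big_ord_recl big_ord0.
  rewrite addr0 addrA /=.
  rewrite !mulr_algl !linfun_scalarE /=.
  by congr (coord e _ c *: _ + coord e _ c *: _ + coord e _ c *: _);
    apply: val_inj.
rewrite {1}[a]coordE {1}[b]coordE !big_ord_recl big_ord0 addr0 /= !add_lfunE.
move: (X i0 a : F) (X i1 a : F) (X i2 a : F) => x0 x1 x2.
move: (X i0 b : F) (X i1 b : F) (X i2 b : F) => y0 y1 y2.
have scaleE (s t : F^o) (z : L) :
    (s * t : F^o) *: z = (s : F)%:A * (t : F)%:A * z.
  by rewrite -[LHS](@scalerA F) -[RHS]mulrA !mulr_algl.
rewrite !scaleE !(scalerDl, rmorphD) /=.
ring.
Qed.

Lemma sym_tensor_rank6 : \dim {:L} = 3%N -> (q <= 3)%N ->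
  is_sym_tensor_rank L 6.
Proof.
move=> dimL q_le3; split=> [|R decR]; first exact: has_decomposition6.
rewrite ltnNge; apply/negP => R_le5; apply: (no_decomposition5 dimL q_le3).
exact: has_decomposition_leq R_le5 decR.
Qed.

End Rank.

Theorem corollary4p5 (q : nat) (F : finFieldType) (L : fieldExtType F)
    (cardF : #|F| = q) (dimL : \dim {:L} = 3%N) :
  (forall xi : L, ~~ root (map_poly (in_alg L) (det_poly F)) xi ->
     [/\ (forall a : L, amull a \in <<power_trace_tensors xi>>%VS),
         (exists (phi : 'I_6 -> 'Hom(L, F^o)) (w : 'I_6 -> L),
            (forall (i : 'I_6) (x : L),
               (phi i x : F)%:A = field_trace (xi ^+ i * x)) /\
            sym_tensor_decomposition phi w)
       & (q = 2%N \/ q = 3%N ->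
          is_sym_tensor_rank L (size (undup (power_trace_tensors xi))))])
  /\ (q = 2%N \/ q = 3%N -> is_sym_tensor_rank L 6).
Proof.
have rank6 : q = 2%N \/ q = 3%N -> is_sym_tensor_rank L 6.
  by move=> q23; apply: sym_tensor_rank6 => //; rewrite cardF; case: q23 => ->.
split=> // xi; rewrite rootE -det_quad_mx_pow => det_neq0.
have [w dec] := quad_mx_decomposition dimL det_neq0.
split.
- move=> a; rewrite (amull_trace_tensors dec); apply: memv_suml => i _.
  apply/rpredZ/memv_span; apply: (map_f (fun n => trace_tensor (xi ^+ n))).
  by rewrite mem_iota ltn_ord.
- exists (fun i : 'I_6 => trace_form (xi ^+ i)), w; split=> [i x|a b].
    by rewrite trace_formE trace_scalarE.
  by rewrite dec; apply: eq_bigr => i _; rewrite !trace_formE.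
suff uniq_tensors : uniq (power_trace_tensors xi) by rewrite undup_id.
rewrite /power_trace_tensors -val_enum_ord -map_comp map_inj_uniq ?enum_uniq //.
exact: trace_tensor_inj det_neq0.
Qed.
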